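(* Let $M\in\mathcal{M}_n(\mathbb{R})$. Then there exists a unique pair $(S,N)\in\mathcal{M}_n(\mathbb{R})^2$ such that: 1) $S$ is semi-simple and $N$ is nilpotent; 2) $M=S+N$ and $SN=NS$.
   Context: Here $n\ge 1$ and $\mathcal{M}_n(\mathbb{R})$ is the set of real $n\times n$ matrices. An endomorphism $u$ of a finite-dimensional $\mathbb{R}$-vector space $E$ is called semi-simple if every subspace $F$ of $E$ stable under $u$ has a complementary subspace in $E$ which is stable under $u$. A matrix in $\mathcal{M}_n(\mathbb{R})$ is called semi-simple if the endomorphism of $\mathbb{R}^n$ it represents in the canonical basis is semi-simple. *)

(* Defs.v *)
From mathcomp Require Import all_boot all_order all_algebra.
From mathcomp Require Import reals.

Set Implicit Arguments.
Unset Strict Implicit.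
Unset Printing Implicit Defensive.

Import GRing.Theory.
Local Open Scope ring_scope.

Definition semisimple_end (K : fieldType) (E : vectType K) (u : 'End(E)) : Prop :=
  forall F : {vspace E}, (u @: F <= F)%VS ->
  exists G : {vspace E},
    [/\ (F + G)%VS = fullv, (F :&: G)%VS = 0%VS & (u @: G <= G)%VS].

(* The vectors of K^n are columns: A represents x |-> A x in the canonical
   basis. *)
Definition mx_end (K : fieldType) (n : nat) (A : 'M[K]_n) : 'End('cV[K]_n) :=
  linfun (mulmx A).

Definition semisimple_mx (K : fieldType) (n : nat) (A : 'M[K]_n) : Prop :=
  semisimple_end (mx_end A).

Definition nilpotent_mx (K : fieldType) (n : nat) (A : 'M[K]_n) : Prop :=
  exists k : nat, A ^+ k = 0.

(* Main.v *)
Require Import Defs.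
From mathcomp Require Import all_boot all_order all_algebra.
From mathcomp Require Import separable.
From mathcomp Require Import reals ring.

Import GRing.Theory.
Local Open Scope ring_scope.

(** The eigenvalues of [M] never appear: a separable polynomial does the work of
    a diagonalization over an algebraic closure.

    In characteristic 0, the characteristic polynomial of [M] divides a power
    [r ^+ k] of a separable polynomial [r] ([dvdp_exp_radical]), so that [r]
    has nilpotent value at [M].  Newton's iteration deforms ['X] into a
    polynomial [s], congruent to ['X] modulo [r], such that [r ^+ k] divides
    [r \Po s] ([newton_root]).  Hence [S := s(M)] is an exact root of [r], and
    [M - S] is nilpotent because it is a multiple of [r(M)].

    Two facts relate semi-simplicity to [r].  A matrix killed by a separable
    polynomial is semi-simple ([separable_semisimple]): any projection onto a
    stable subspace can be averaged into one that commutes with the matrix, and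
    the kernel of the latter is the complement.  Conversely, if [A] is
    semi-simple, a polynomial in [A] that is nilpotent is zero
    ([semisimple_horner_nilpotent]).

    For uniqueness, let [M = S' + N'] be another decomposition.  As [r(M)] is
    nilpotent, so is [r(S')], hence [r(S') = 0] ([semisimple_part_root]).  Thus
    [S] and [S'] are roots of the same separable polynomial; they commute,
    because [S] is a polynomial in [M], and they differ by a nilpotent matrix.
    Since the roots of [r] are simple, [S = S'] ([separable_root_unique]). *)

(** * Separable radical of a polynomial *)

Lemma dvdp_deriv_pchar0 (K : fieldType) (d : {poly K}) :
  [pchar K] =i pred0 -> d != 0 -> d %| d^`() -> size d = 1%N.
Proof.
move=> char0 d_neq0 d_dvd.
have d'0 : d^`() = 0.
  apply/eqP; apply: contraTT (lt_size_deriv d_neq0) => d'_neq0.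
  by rewrite -leqNgt dvdp_leq.
have := d_neq0; rewrite -size_poly_gt0; case sz: (size d) => [|[|m]] // _.
have := congr1 (coefp m) d'0; rewrite /= coef_deriv coef0 => /eqP.
rewrite -mulr_natr mulf_eq0 ((pcharf0P K).1 char0) orbF => /eqP lead0.
by case/eqP: d_neq0; apply/eqP; rewrite -lead_coef_eq0 lead_coefE sz /= lead0.
Qed.

(** The quotient [r] of [p] by [gcdp p p^`()] has all irreducible factors of
    [p].  Without factoring: write the gcd as [d * e], where [e] is its part
    prime to [r] and [d] divides a power of [r].  Then [p = r * d * e] with [e]
    prime to [r * d]; as [e] divides [p^`()], it divides its own derivative, and
    is therefore constant. *)
Lemma dvdp_exp_radical (K : fieldType) (p : {poly K}) :
  [pchar K] =i pred0 -> p != 0 ->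
  exists k, p %| (p %/ gcdp p p^`()) ^+ k.
Proof.
move=> char0 p_neq0; set g := gcdp p p^`(); set r := p %/ g.
have g_neq0 : g != 0 by rewrite gcdp_eq0 negb_and p_neq0.
have pE : p = r * g by rewrite divpK ?dvdp_gcdl.
have r_neq0 : r != 0 by apply: contraNneq p_neq0 => r0; rewrite pE r0 mul0r.
have [d gE] := dvdpP _ _ (dvdp_gdco r g).
have e_dvd := dvdp_gdcor g r_neq0; have cdr := coprimep_gdco r g_neq0.
move: (gdcop r g) => e in gE e_dvd cdr *.
have [e_neq0 d_neq0] : e != 0 /\ d != 0.
  by split; apply: contraNneq g_neq0 => z; rewrite gE z ?mulr0 ?mul0r.
have {}e_dvd : d %| r ^+ size g.
  by move: e_dvd; rewrite [X in X %| _]gE mulrC dvdp_mul2l.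
have ced : coprimep e d.
  exact: coprimep_dvdl e_dvd (coprimep_expr _ cdr).
have e1 : size e = 1%N.
  apply: dvdp_deriv_pchar0 => //.
  have : e %| (r * d * e)^`().
    rewrite -mulrA -gE -pE; apply: dvdp_trans (dvdp_gcdr p _).
    by rewrite -/g gE dvdp_mulIr.
  by rewrite derivM dvdp_addr ?dvdp_mulIr // -mulrA !Gauss_dvdpr.
exists (size g).+1; rewrite pE exprS dvdp_mul2l //.
have /size_poly1P[c c_neq0 eE] : size e == 1%N by apply/eqP.
by rewrite [X in X %| _]gE eE mulrC mul_polyC dvdpZl.
Qed.

(** * Second-order Taylor expansion *)

(** The coefficients may lie in a noncommutative ring, so that this covers both
    the evaluation of polynomials at matrices and their composition. *)
Lemma horner_taylor2 (R : nzRingType) (p : {poly R}) (x h : R) :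
  (forall i, GRing.comm h p`_i) -> GRing.comm h x ->
  exists2 e, GRing.comm h e & p.[x + h] = p.[x] + p^`().[x] * h + e * h ^+ 2.
Proof.
move=> cph cxh.
exists (\sum_(i < size p) p^`N(i.+2).[x] * h ^+ i).
  apply: commr_sum => i _; apply: commrM; last exact/commrX.
  rewrite horner_coef; apply: commr_sum => j _; apply: commrM; last exact/commrX.
  by rewrite coef_nderivn; apply/commrMn/cph.
have le_sz : (size p <= (size p).+2)%N by rewrite ltnW.
rewrite (nderiv_taylor_wide (commr_sym cxh) le_sz).
rewrite !big_ord_recl /= nderivn0 nderivn1 expr0 expr1 mulr1 addrA; congr (_ + _).
by rewrite mulr_suml; apply: eq_bigr => i _; rewrite -mulrA -exprD addn2.
Qed.

Lemma horner_mx_taylor2 (K : fieldType) n (A H : 'M[K]_n.+1) (p : {poly K}) :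
  GRing.comm H A ->
  exists2 E, GRing.comm H E &
    horner_mx (A + H) p =
      horner_mx A p + horner_mx A p^`() * H + E * H ^+ 2.
Proof.
move=> cHA; have [|E cHE EE] := @horner_taylor2 _ (map_poly scalar_mx p) A H _ cHA.
  by move=> i; rewrite coef_map; apply: comm_mx_scalar.
by exists E => //; rewrite /horner_mx /horner_morph EE deriv_map.
Qed.

(** * Newton's iteration *)

Lemma horner_mx_comp (K : fieldType) n (A : 'M[K]_n.+1) (p q : {poly K}) :
  horner_mx A (p \Po q) = horner_mx (horner_mx A q) p.
Proof.
elim/poly_ind: p => [|p c IH]; first by rewrite comp_poly0 !rmorph0.
by rewrite comp_polyD comp_polyM comp_polyX comp_polyC !rmorphD !rmorphM /=
  IH !horner_mx_C !horner_mx_X.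
Qed.

(** If [w := r(s)], and [v] is inverse to [r^`()] modulo [r], the Newton step
    [s - w * v(s)] makes [r(s)] divisible by [w ^+ 2], hence by one more power
    of [r]. *)
Lemma newton_root (K : fieldType) (r : {poly K}) k :
  separable_poly r ->
  exists2 s : {poly K}, r %| s - 'X & r ^+ k.+1 %| r \Po s.
Proof.
rewrite unlock => /Bezout_eq1_coprimepP[[u v] /= uv1].
elim: k => [|k [s rs rks]]; first by exists 'X; rewrite ?subrr ?dvdp0 ?comp_polyXr.
set w := r \Po s in rks *.
have r_dvd_w : r %| w by apply: dvdp_trans rks; rewrite exprS dvdp_mulIl.
exists (s - w * (v \Po s)).
  by rewrite addrAC dvdp_sub // dvdp_mulr.
have [| |e _ Ee] := @horner_taylor2 _ (map_poly polyC r) s (- (w * (v \Po s))).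
- by move=> i; apply: mulrC.
- exact: mulrC.
rewrite /comp_poly Ee deriv_map.
have uvs : (u \Po s) * w + (v \Po s) * (r^`() \Po s) = 1.
  by rewrite -!rmorphM -rmorphD /= uv1 comp_polyC.
rewrite -/(r \Po s) -/(r^`() \Po s) -/w.
have -> : w + (r^`() \Po s) * - (w * (v \Po s)) + e * (- (w * (v \Po s))) ^+ 2
   = w * w * ((u \Po s) + e * (v \Po s) ^+ 2).
  by rewrite -{1}[w]mulr1 -uvs; ring.
by rewrite exprSr dvdp_mulr // dvdp_mul.
Qed.

(** * Stable subspaces of a matrix *)

Lemma mx_endE (K : fieldType) n (A : 'M[K]_n) v : mx_end A v = A *m v.
Proof. by rewrite lfunE. Qed.

Lemma mx_end_surj (K : fieldType) n (f : 'End('cV[K]_n)) :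
  exists P, f = mx_end P.
Proof.
exists (\matrix_(i, j) f (delta_mx j 0) i 0); apply/lfunP => v.
rewrite mx_endE {1}(matrix_sum_delta v) linear_sum /=.
apply/colP => i; rewrite summxE mxE; apply: eq_bigr => j _.
by rewrite big_ord1 linearZ /= !mxE mulrC.
Qed.

Lemma stable_mx_endP (K : fieldType) n (A : 'M[K]_n) (F : {vspace 'cV[K]_n}) :
  reflect (forall v, v \in F -> A *m v \in F) (mx_end A @: F <= F)%VS.
Proof.
apply: (iffP subvP) => [sF v vF | sF _ /memv_imgP[v vF ->]].
  by rewrite -mx_endE; apply/sF/memv_img.
by rewrite mx_endE sF.
Qed.

Lemma stable_horner_mx (K : fieldType) n (A : 'M[K]_n.+1)
    (F : {vspace 'cV[K]_n.+1}) p v :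
  (mx_end A @: F <= F)%VS -> v \in F -> horner_mx A p *m v \in F.
Proof.
move=> /stable_mx_endP sF vF; elim/poly_ind: p => [|p c IH].
  by rewrite rmorph0 mul0mx mem0v.
rewrite rmorphD rmorphM /= horner_mx_X horner_mx_C mulmxDl mul_scalar_mx.
rewrite memvD ?memvZ // [_ * _]comm_horner_mx // -mulmxA; exact: sF.
Qed.

(** The kernel of [B := p(A)] is stable under [A].  On a stable complement, [B]
    is both injective and nilpotent, so this complement is zero. *)
Lemma semisimple_horner_nilpotent (K : fieldType) n (A : 'M[K]_n.+1) p :
  semisimple_mx A -> nilpotent_mx (horner_mx A p) -> horner_mx A p = 0.
Proof.
move=> ssA [k Bk0]; set B := horner_mx A p in Bk0 *.
have sF : (mx_end A @: lker (mx_end B) <= lker (mx_end B))%VS.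
  apply/stable_mx_endP => v; rewrite !memv_ker !mx_endE => /eqP Bv0.
  have cBA : B *m A = A *m B by exact: comm_horner_mx.
  by rewrite mulmxA cBA -mulmxA Bv0 mulmx0.
have [G [FG1 FG0 sG]] := ssA _ sF.
have G0 j v : v \in G -> B ^+ j *m v = 0 -> v = 0.
  elim: j v => [|j IH] v vG; first by rewrite mul1mx.
  rewrite exprSr -mulmxA => /IH Bv0; apply/eqP.
  rewrite -memv0 -FG0 memv_cap vG andbT memv_ker mx_endE Bv0 //.
  exact: stable_horner_mx.
have F1 : lker (mx_end B) = fullv.
  rewrite -FG1; suff -> : G = 0%VS by rewrite addv0.
  apply/eqP; rewrite -subv0; apply/subvP => v vG.
  by rewrite memv0 (G0 k v) // Bk0 mul0mx.
apply/eqP; rewrite -trmx_eq0; apply/eqP/row_matrixP => i.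
rewrite row0 -tr_col; apply/eqP; rewrite trmx_eq0 colE -mx_endE -memv_ker.
by rewrite F1 memvf.
Qed.

(** The matrix [D] is the value at [p] of the derivation, into the bimodule of
    matrices, that sends ['X] to [P]: a monomial ['X^m] contributes its
    coefficient times the sum of the [A ^+ i * P * A ^+ j] for [i + j + 1 = m].
    On [F], where [P] is the
    identity, it reduces to the ordinary derivative.  Induction on [p] replaces
    the explicit double sum. *)
Lemma horner_mx_derivation (K : fieldType) n (A P : 'M[K]_n.+1)
    (F : {vspace 'cV[K]_n.+1}) (p : {poly K}) :
  (mx_end A @: F <= F)%VS -> (forall v, P *m v \in F) ->
  {in F, forall v, P *m v = v} ->
  exists D : 'M[K]_n.+1,
    [/\ A * D - D * A = horner_mx A p * P - P * horner_mx A p,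
        forall v, D *m v \in F
      & {in F, forall v, D *m v = horner_mx A p^`() *m v}].
Proof.
move=> sF PF Pid; have /stable_mx_endP sFA := sF.
elim/poly_ind: p => [|p c [D [cD DF Did]]].
  exists 0; rewrite deriv0 rmorph0 !mulr0 !mul0r; split=> // v.
  by rewrite mul0mx mem0v.
have pA : horner_mx A p * A = A * horner_mx A p by exact: comm_horner_mx.
exists (A * D + P * horner_mx A p); split=> [|v|v vF].
- rewrite rmorphD rmorphM /= horner_mx_X horner_mx_C.
  have -> : (horner_mx A p * A + c%:M) * P - P * (horner_mx A p * A + c%:M)
     = A * (horner_mx A p * P) - P * horner_mx A p * A.
    rewrite mulrDl mulrDr [P * c%:M]comm_mx_scalar opprD addrACA subrr addr0.
    by rewrite !mulrA pA.
  rewrite mulrDr mulrDl opprD addrACA -!mulrA -mulrBr cD.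
  by rewrite mulrBr !mulrA addrA subrK.
- by rewrite mulmxDl -!mulmxA memvD ?sFA.
- rewrite derivMXaddC rmorphD rmorphM /= horner_mx_X !mulmxDl -!mulmxA Did //.
  rewrite Pid ?stable_horner_mx // addrC; congr (_ + _).
  by rewrite !mulmxA [_ *m A]comm_horner_mx.
Qed.

Lemma separable_deriv_inv (K : fieldType) n (A : 'M[K]_n.+1) p :
  separable_poly p -> horner_mx A p = 0 ->
  exists v, horner_mx A p^`() * horner_mx A v = 1.
Proof.
rewrite unlock => /Bezout_eq1_coprimepP[[u v] /= uv1] pA0; exists v.
rewrite -(rmorph1 (horner_mx A)) -uv1 rmorphD !rmorphM /= pA0 mulr0 add0r.
exact: comm_horner_mx2.
Qed.

(** Averaging as in Maschke's theorem.  When [p(A) = 0], the matrix [D] above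
    commutes with [A]; composing it with the inverse of [p^`()(A)] gives a
    projection onto [F] that still commutes with [A]. *)
Lemma separable_semisimple (K : fieldType) n (A : 'M[K]_n.+1) p :
  separable_poly p -> horner_mx A p = 0 -> semisimple_mx A.
Proof.
move=> sep_p pA0 F sF; have [v p'v1] := separable_deriv_inv _ _ _ _ sep_p pA0.
have [P EP] := mx_end_surj _ _ (projv F).
have PF w : P *m w \in F by rewrite -mx_endE -EP memv_proj.
have Pid : {in F, forall w, P *m w = w}.
  by move=> w wF; rewrite -mx_endE -EP projv_id.
have [D [cD DF Did]] := @horner_mx_derivation _ _ _ _ _ p sF PF Pid.
move: cD; rewrite pA0 mul0r mulr0 subrr => /eqP; rewrite subr_eq0 => /eqP cD.
set Q := D * horner_mx A v.
have QF w : Q *m w \in F by rewrite -mulmxA.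
have Qid : {in F, forall w, Q *m w = w}.
  move=> w wF; rewrite -mulmxA Did ?stable_horner_mx // mulmxA.
  by rewrite [X in X *m w]p'v1 mul1mx.
have cQ : A * Q = Q * A.
  by rewrite mulrA cD -!mulrA [A * _](@comm_mx_horner _ _ A A v).
exists (lker (mx_end Q)); split.
- apply/vspaceP => w; rewrite memvf.
  rewrite -(subrK (Q *m w) w) addrC memv_add // memv_ker mx_endE mulmxBr.
  by rewrite (Qid (Q *m w)) ?subrr.
- apply/eqP; rewrite -subv0; apply/subvP => w; rewrite memv_cap memv_ker mx_endE.
  by case/andP => /Qid ->; rewrite memv0.
- apply/stable_mx_endP => w; rewrite !memv_ker !mx_endE => /eqP Qw0.
  by rewrite mulmxA -[Q *m A]cQ -mulmxA Qw0 mulmx0.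
Qed.

(** * Uniqueness *)

Lemma nilpotent_mull (K : fieldType) n (A E : 'M[K]_n.+1) :
  GRing.comm A E -> nilpotent_mx A -> nilpotent_mx (E * A).
Proof.
by move=> cAE [k Ak0]; exists k; rewrite exprMn_comm ?Ak0 ?mulr0.
Qed.

Lemma nilpotentB (K : fieldType) n (A B : 'M[K]_n.+1) :
  GRing.comm A B -> nilpotent_mx A -> nilpotent_mx B -> nilpotent_mx (A - B).
Proof.
move=> cAB [j Aj0] [k Bk0]; exists (j + k)%N.
rewrite exprBn_comm // big1 // => i _.
have [k_le|i_lt] := leqP k i.
  by rewrite -(subnK k_le) [B ^+ _]exprD Bk0 !mulr0 mul0rn.
have -> : (j + k - i = k - i + j)%N by rewrite -addnBA 1?ltnW // addnC.
by rewrite exprD Aj0 !(mulr0, mul0r) mul0rn.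
Qed.

(** Modulo [N], the values of [p ^+ k] at [S] and at [S + N] agree, so
    [(p ^+ k)(S)] is a multiple of the nilpotent [N]. *)
Lemma semisimple_part_root (K : fieldType) n (S N : 'M[K]_n.+1) p k :
  semisimple_mx S -> nilpotent_mx N -> GRing.comm N S ->
  horner_mx (S + N) (p ^+ k) = 0 -> horner_mx S p = 0.
Proof.
move=> ssS nilN cNS pk0; apply: semisimple_horner_nilpotent => //.
have [E cNE] := @horner_mx_taylor2 _ _ S N (p ^+ k) cNS.
rewrite pk0 -addrA => /esym/eqP; rewrite addr_eq0 => /eqP pkS.
set C := horner_mx S (p ^+ k)^`() + E * N.
have [j Cj0] : nilpotent_mx (- C * N).
  apply: nilpotent_mull => //; apply/commrN/commrD.
    exact: comm_mx_horner.
  exact: commrM.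
exists (k * j)%N; rewrite exprM -rmorphXn /= pkS -[RHS]Cj0.
by rewrite mulNr mulrDl -mulrA expr2.
Qed.

(** Taylor's formula at [S] gives [p^`()(S) * D + E * D ^+ 2 = 0] for
    [D := T - S], with [p^`()(S)] invertible.  Multiplying by [D ^+ k] turns
    [D ^+ k.+2 = 0] into [D ^+ k.+1 = 0]. *)
Lemma separable_root_unique (K : fieldType) n (S T : 'M[K]_n.+1) p :
  separable_poly p -> GRing.comm S T -> nilpotent_mx (T - S) ->
  horner_mx S p = 0 -> horner_mx T p = 0 -> S = T.
Proof.
move=> sep_p cST [k]; set D := T - S => Dk0 pS0 pT0.
have [v p'v1] := separable_deriv_inv _ _ _ _ sep_p pS0.
have TE : T = S + D by rewrite addrC subrK.
have cDS : GRing.comm D S.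
  by apply/commr_sym/commrB.
have [E _] := @horner_mx_taylor2 _ _ S D p cDS.
rewrite -TE pT0 pS0 add0r => /esym ED0.
have vp'1 : horner_mx S v * horner_mx S p^`() = 1.
  by rewrite -p'v1; exact: comm_horner_mx2.
suff: D = 0 by move/eqP; rewrite subr_eq0 => /eqP.
elim: k Dk0 => [|[|k] IH] Dk0; first by rewrite -[D]mulr1 -[1](expr0 D) Dk0 mulr0.
  by rewrite -Dk0.
apply: IH; rewrite -[LHS]mul1r -vp'1 -mulrA.
have := congr1 ( *%R^~ (D ^+ k)) ED0.
rewrite mul0r mulrDl -!mulrA -!exprS Dk0 mulr0 addr0 => ->.
by rewrite mulr0.
Qed.

(** * Jordan-Chevalley decomposition *)

Theorem mainTheorem2 (R : realType) (n : nat) (n_ge1 : (1 <= n)%N)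
    (M : 'M[R]_n) :
  exists! SN : 'M[R]_n * 'M[R]_n,
    (semisimple_mx SN.1 /\ nilpotent_mx SN.2) /\
    (M = SN.1 + SN.2 /\ SN.1 *m SN.2 = SN.2 *m SN.1).
Proof.
case: n n_ge1 M => // n _ M.
have chi_neq0 : char_poly M != 0 by rewrite monic_neq0 ?char_poly_monic.
have [k chi_dvd] := @dvdp_exp_radical _ _ (@Num.Theory.pchar_num R) chi_neq0.
set r := _ %/ _ in chi_dvd.
have sep_r : separable_poly r by exact: make_separable.
have rk0 : horner_mx M (r ^+ k) = 0.
  case/dvdpP: chi_dvd => q ->.
  by rewrite rmorphM /= Cayley_Hamilton mulr0.
have [s /dvdpP[q sX] /dvdpP[c rs]] := @newton_root _ r k sep_r.
set S := horner_mx M s.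
have rS0 : horner_mx S r = 0.
  by rewrite -horner_mx_comp rs exprS mulrA rmorphM /= rk0 mulr0.
have comS A : GRing.comm A M -> GRing.comm A S by exact: comm_mx_horner.
have nilMS : nilpotent_mx (M - S).
  exists k; rewrite -opprB -[in S - M](horner_mx_X M) -rmorphB sX.
  by rewrite exprNn -rmorphXn exprMn rmorphM /= rk0 !mulr0.
exists (S, M - S); split => /= [|[S' N'] /= [[ssS' nilN'] [ME cSN']]].
  split; first by split=> //; exact: separable_semisimple sep_r rS0.
  split; first by rewrite addrC subrK.
  by apply: commrB => //; apply/commr_sym/comS.
have cN'S' : GRing.comm N' S' by exact/esym.
have cN'M : GRing.comm N' M by rewrite ME; apply: commrD.
have cS'M : GRing.comm S' M by rewrite ME; apply: commrD.
have rS'0 : horner_mx S' r = 0.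
  by apply: (@semisimple_part_root _ _ S' N' r k); rewrite -?ME.
suff -> : S = S' by rewrite [in M - _]ME addrC addKr.
apply/esym/(@separable_root_unique _ _ S' S r) => //; first exact: comS.
have -> : S - S' = N' - (M - S)
  by rewrite opprB addrCA [in RHS]ME opprD [N' + _]addrCA subrr addr0.
apply: nilpotentB => //; apply: commrB => //; exact: comS.
Qed.
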